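(* Let $0\le i<j$ be indices of downstream boundary condition blocks, and suppose that $N_{c_{down}^j}(x_0,t')\le N_{c_{down}^i}(x_0,t')$ for some time $t'>t_j+\frac{x_{n_{ini}}-x_0}{w}$. Then $$\forall t>t',\qquad N_{c_{down}^j}(x_0,t)\le N_{c_{down}^i}(x_0,t).$$
   Context: Fundamental diagram: $Q:[0,k_{jam}]\to[0,\infty)$ is a concave function with $Q(0)=Q(k_{jam})=0$. The free-flow speed is $v_f=Q'(0^+)>0$ and the congested wave speed is $w>0$ with $-w=Q'(k_{jam}^-)$ (both finite). The convex transform of $Q$ is $R(u)=\sup_{k\in[0,k_{jam}]}(Q(k)-uk)$ for $u\in[-w,v_f]$. The road link is the interval $[x_0,x_{n_{ini}}]$ with $x_0<x_{n_{ini}}$. With $0=t_0<t_1<t_2<\dots$, the $j$-th downstream boundary condition block, imposed at $x=x_{n_{ini}}$, is $c_{down}^j(t)=p_jt+c_j$ for $t_j\le t\le t_{j+1}$ and $+\infty$ otherwise. The flows satisfy $0\le p_j\le\max Q$ and consecutive blocks agree at their common endpoint. The solution component associated with block $j$ is given by the Lax-Hopf formula: for $x\in[x_0,x_{n_{ini}})$ and $t>0$, $$N_{c_{down}^j}(x,t)=\inf\{c_{down}^j(s)+(t-s)R(\tfrac{x-x_{n_{ini}}}{t-s}) : s\in[t_j,t_{j+1}],\ s<t,\ -w\le\tfrac{x-x_{n_{ini}}}{t-s}\},$$ with the infimum over the empty set equal to $+\infty$. *)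

(* Defs.v *)
(* MathComp-Analysis; real numbers are an abstract [R : realType]. *)
From mathcomp Require Import all_boot all_order all_algebra.
From mathcomp Require Import all_classical all_reals all_analysis.
Set Implicit Arguments.
Unset Strict Implicit.
Unset Printing Implicit Defensive.
Import Order.TTheory GRing.Theory Num.Theory.
Import numFieldNormedType.Exports.
Local Open Scope classical_set_scope.
Local Open Scope ring_scope.

Definition has_right_derivative (R : realType) (f : R -> R) (a l : R) : Prop :=
  (f (a + h) - f a) / h @[h --> 0^'+] --> l.

Definition has_left_derivative (R : realType) (f : R -> R) (a l : R) : Prop :=
  (f (a + h) - f a) / h @[h --> 0^'-] --> l.

(* [Q] is a total function; only its values on [0, kjam] are constrained. *)
Record fundamental_diagram (R : realType) (Q : R -> R) (kjam vf w : R) : Prop :=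
  FundamentalDiagram {
    fd_kjam_gt0 : 0 < kjam ;
    fd_ge0 : forall k : R, 0 <= k <= kjam -> 0 <= Q k ;
    fd_concave : convex_function (`[0, kjam] : set R^o) (fun k : R^o => - Q k) ;
    fd_at0 : Q 0 = 0 ;
    fd_at_kjam : Q kjam = 0 ;
    fd_vf_gt0 : 0 < vf ;
    fd_vf : has_right_derivative Q 0 vf ;
    fd_w_gt0 : 0 < w ;
    fd_w : has_left_derivative Q kjam (- w)
  }.

(* The supremum is attained: a concave [Q] with finite one-sided derivatives
   at the endpoints is continuous on [0, kjam]. *)
Definition max_flow (R : realType) (Q : R -> R) (kjam : R) : R :=
  sup [set Q k | k in `[0, kjam]].

(* A real [sup] suffices: concavity gives Q k <= vf * k on [0, kjam], so the
   set is bounded above, and it is nonempty. *)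
Definition convex_transform (R : realType) (Q : R -> R) (kjam u : R) : R :=
  sup [set Q k - u * k | k in `[0, kjam]].

(* Block [j] lives on [tau j, tau j.+1], with flow [p j] and constant [c j]. *)
Record downstream_condition (R : realType) (Q : R -> R) (kjam : R)
    (tau p c : nat -> R) : Prop := DownstreamCondition {
  dc_tau0 : tau 0%N = 0 ;
  dc_tau_lt : forall j : nat, tau j < tau j.+1 ;
  dc_flow : forall j : nat, 0 <= p j <= max_flow Q kjam ;
  dc_continuous : forall j : nat,
    p j * tau j.+1 + c j = p j.+1 * tau j.+1 + c j.+1
}.

Definition c_down (R : realType) (tau p c : nat -> R) (j : nat) (t : R) :
    \bar R :=
  if tau j <= t <= tau j.+1 then (p j * t + c j)%:E else +oo%E.

(* [xn] is the downstream end of the link. For x < xn the velocity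
   (x - xn) / (t - s) is negative, so it lies in [-w, vf] as soon as it is at
   least -w. [ereal_inf set0 = +oo]. *)
Definition N_down (R : realType) (Q : R -> R) (kjam w xn : R)
    (tau p c : nat -> R) (j : nat) (x t : R) : \bar R :=
  ereal_inf
    [set (c_down tau p c j s
          + ((t - s) * convex_transform Q kjam ((x - xn) / (t - s)))%:E)%E
    | s in [set s : R | [/\ tau j <= s <= tau j.+1, s < t
                          & - w <= (x - xn) / (t - s)]]].

(* Main.v *)
Require Import Defs.
From mathcomp Require Import all_boot all_order all_algebra.
From mathcomp Require Import all_classical all_reals all_analysis.
From mathcomp Require Import ring lra.
Set Implicit Arguments.
Unset Strict Implicit.
Import Order.TTheory GRing.Theory Num.Theory.
Import numFieldNormedType.Exports.
Local Open Scope classical_set_scope.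
Local Open Scope ring_scope.

(** Fix the upstream end x0 of the link and put y = x0 - xn. Emitting at time
    s and arriving at time t costs c(s) + L(t - s), where L(d) = d R(y / d).
    Since d (Q k - (y / d) k) = d Q(k) - y k, the function L is a supremum of
    affine functions of d, hence convex: its increment over a time span h is
    nondecreasing in the starting duration ([scaled_transform_increment]).

    An emission time s2 in block j is at least any emission time s1 in block i,
    so t' - s2 <= t' - s1, and from t' to t the cost of s2 grows no more than
    the cost of s1. A comparison between the two valid at t' therefore persists
    at every t > t'. This transfers to the infima provided that every s1
    competing at time t already competes at t', and this is what
    t' > tau j + (xn - x0) / w gives: block i is over by time tau j, so by t'
    the fastest wave, of speed w, has reached x0 from every point of block i.
    Choosing s2 optimal only up to an arbitrary e > 0 spares any argument that
    the infimum for block j is attained. *)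

(** The suprema defining the convex transform are thus finite. The midpoint
    kjam / 2 is the centre of the segment from k to kjam - k, so concavity
    gives Q (kjam / 2) >= (Q k + Q (kjam - k)) / 2 >= Q k / 2. *)
Lemma fundamental_diagram_bounded (R : realType) (Q : R -> R) (kjam vf w k : R) :
  fundamental_diagram Q kjam vf w -> 0 <= k <= kjam ->
  Q k <= 2 * Q (kjam / 2).
Proof.
move=> hQ hk.
have hk' : 0 <= kjam - k <= kjam by lra.
have Q0 := fd_ge0 hQ hk'.
have half_ge0 : 0 <= 2^-1 :> R by lra.
have half_le1 : 2^-1 <= 1 :> R by lra.
have := fd_concave hQ (Itv01 half_ge0 half_le1) (x := k) (y := kjam - k).
rewrite !inE /= !in_itv /= => /(_ hk hk').
rewrite !convRE /= /unstable.onem.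
rewrite [X in - Q X <= _](_ : _ = kjam / 2); first by lra.
by change (2^-1 * k + (1 - 2^-1) * (kjam - k) = kjam / 2); field.
Qed.

Section ConvexTransform.

Variables (R : realType) (Q : R -> R) (kjam M y : R).
Hypothesis kjam_ge0 : 0 <= kjam.
Hypothesis Q_le : forall k, 0 <= k <= kjam -> Q k <= M.

Let L d := d * convex_transform Q kjam (y / d).

Lemma scaled_transform_ge d k : 0 < d -> 0 <= k <= kjam ->
  d * Q k - y * k <= L d.
Proof.
move=> d0 hk.
have -> : d * Q k - y * k = d * (Q k - y / d * k) by field; rewrite gt_eqF.
rewrite /L ler_pM2l //; apply: ub_le_sup; last by exists k; rewrite //= in_itv.
exists (M + `|y / d| * kjam) => _ [l + <-]; rewrite /= in_itv /= => hl.
have [l0 lk] := andP hl.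
apply: lerD; first exact: Q_le.
rewrite -mulNr (le_trans (ler_norm _)) // normrM normrN.
by rewrite ler_wpM2l // ger0_norm.
Qed.

Lemma scaled_transform_le d B : 0 < d ->
  (forall k, 0 <= k <= kjam -> d * Q k - y * k <= B) -> L d <= B.
Proof.
move=> d0 hB; rewrite /L mulrC -ler_pdivlMr //; apply: ge_sup.
  by exists (Q 0 - y / d * 0), 0; rewrite //= in_itv /= lexx.
move=> _ [k + <-]; rewrite /= in_itv /= => hk.
rewrite ler_pdivlMr //.
have -> : (Q k - y / d * k) * d = d * Q k - y * k by field; rewrite gt_eqF.
exact: hB.
Qed.

(** Convexity of L, by exchange: let k1, k2 be densities competing for
    L (a + h) and L b. Both durations lie between a and b + h and have the same
    sum, so giving b + h to the density of larger flow, and a to the other one,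
    does not decrease the total. *)
Lemma scaled_transform_increment a b h : 0 < a -> a <= b -> 0 <= h ->
  L (a + h) + L b <= L a + L (b + h).
Proof.
move=> a0 ab h0.
have b0 : 0 < b by lra.
have bh0 : 0 < b + h by lra.
rewrite -lerBrDr; apply: scaled_transform_le => [|k1 hk1]; first lra.
rewrite lerBrDr -lerBrDl; apply: scaled_transform_le => // k2 hk2.
have [Q12|Q21] := leP (Q k1) (Q k2).
- have := scaled_transform_ge a0 hk1; have := scaled_transform_ge bh0 hk2.
  have := mulr_ge0 h0 (_ : 0 <= Q k2 - Q k1); rewrite subr_ge0 => /(_ Q12).
  lra.
- have := scaled_transform_ge a0 hk2; have := scaled_transform_ge bh0 hk1.
  have ba : 0 <= b - a by lra.
  have := mulr_ge0 ba (_ : 0 <= Q k1 - Q k2).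
  rewrite subr_ge0 => /(_ (ltW Q21)).
  lra.
Qed.

End ConvexTransform.

Theorem theorem6 (R : realType) (Q : R -> R) (kjam vf w : R)
    (hQ : fundamental_diagram Q kjam vf w)
    (x0 xn : R) (hx : x0 < xn)
    (tau p c : nat -> R) (hdown : downstream_condition Q kjam tau p c)
    (i j : nat) (hij : (i < j)%N)
    (t' : R) (ht' : tau j + (xn - x0) / w < t')
    (hle : (N_down Q kjam w xn tau p c j x0 t'
            <= N_down Q kjam w xn tau p c i x0 t')%E) :
  forall t : R, t' < t ->
    (N_down Q kjam w xn tau p c j x0 t
     <= N_down Q kjam w xn tau p c i x0 t)%E.
Proof.
move=> t tt'.
have w0 := fd_w_gt0 hQ.
have speed_ge d : 0 < d -> (- w <= (x0 - xn) / d) = (xn - x0 <= w * d).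
  by move=> d0; rewrite ler_pdivlMr // mulNr lerNl opprB.
have tau_ij : tau i.+1 <= tau j.
  apply: (homo_leq (r := fun x y : R => x <= y)) hij => //.
    by move=> ? ? ?; apply: le_trans.
  by move=> n; apply/ltW/(dc_tau_lt hdown).
apply: le_ereal_inf_tmp => _ [s1 [hs1 s1t _] <-].
rewrite /c_down hs1 -EFinD; apply/lee_addgt0Pr => e e0.
have s1j : s1 <= tau j by case/andP: hs1 => _ /le_trans; apply.
have Dw : (xn - x0) / w < t' - s1 by lra.
have d1 : 0 < t' - s1 by apply: le_lt_trans Dw; rewrite divr_ge0 ?ltW ?subr_gt0.
have hs1' : - w <= (x0 - xn) / (t' - s1).
  by rewrite speed_ge // mulrC -ler_pdivrMr // ltW.
have : (N_down Q kjam w xn tau p c j x0 t' <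
  (p i * s1 + c i
   + (t' - s1) * convex_transform Q kjam ((x0 - xn) / (t' - s1)) + e)%:E)%E.
  apply: (le_lt_trans hle); apply: (@le_lt_trans _ _ (p i * s1 + c i
   + (t' - s1) * convex_transform Q kjam ((x0 - xn) / (t' - s1)))%:E).
    apply: ereal_inf_lbound; exists s1; last by rewrite /c_down hs1.
    by split=> //; rewrite -subr_gt0.
  by rewrite lte_fin ltrDl.
case/ereal_inf_lt => _ [s2 [hs2 s2t' vs2] <-].
rewrite /c_down hs2 -EFinD lte_fin => cmp.
have d2 : 0 < t' - s2 by rewrite subr_gt0.
have d2t : 0 < t - s2 by lra.
apply: (@le_trans _ _ (p j * s2 + c j
   + (t - s2) * convex_transform Q kjam ((x0 - xn) / (t - s2)))%:E).
  apply: ereal_inf_lbound; exists s2; last by rewrite /c_down hs2.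
  split=> //; first by rewrite -subr_gt0.
  move: vs2; rewrite !speed_ge // => /le_trans; apply.
  by rewrite ler_pM2l // lerD2r ltW.
rewrite -EFinD lee_fin.
have s12 : t' - s2 <= t' - s1.
  by rewrite lerD2l lerN2; case/andP: hs2 => s2j _; apply: le_trans s2j.
have h0 : 0 <= t - t' by rewrite subr_ge0 ltW.
have := scaled_transform_increment (x0 - xn) (ltW (fd_kjam_gt0 hQ))
  (fun k => fundamental_diagram_bounded hQ (k := k)) d2 s12 h0.
have shift s : t' - s + (t - t') = t - s by ring.
rewrite !shift; lra.
Qed.
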